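(* Let $A\in\mathbb{R}^{m\times n}$, let $x^\dagger$ (with values in $\mathbb{R}^n$) and $\varepsilon$ (with values in $\mathbb{R}^m$) be uncorrelated, square-integrable random variables with $\mathbb{E}(x^\dagger)=\mu_{x^\dagger}$, $\operatorname{Cov}(x^\dagger)=\Sigma_{x^\dagger}$, $\mathbb{E}(\varepsilon)=0$ and $\operatorname{Cov}(\varepsilon)=\Sigma_\varepsilon$, where $\Sigma_{x^\dagger}$ and $\Sigma_\varepsilon$ are invertible, and let $y=Ax^\dagger+\varepsilon$. The bilevel learning problem $$\min_{\Omega,R,x_0}\ \mathbb{E}\,\|\hat x-x^\dagger\|^2\quad\text{s.t.}\quad \hat x=\operatorname*{argmin}_{x\in\mathbb{R}^n}\ \tfrac12\|Ax-y\|_\Omega^2+\tfrac12\|R(x-x_0)\|^2$$ is solved by any $R$, $\Omega$ and $x_0$ with $$\Omega=\Sigma_\varepsilon^{-1},\qquad R^TR=\Sigma_{x^\dagger}^{-1},\qquad x_0=\mu_{x^\dagger}.$$ Especially, the respective affine map $y\mapsto\hat x$ is equal to the LMMSE map $y\mapsto W^*y+b^*$, where $$W^*=\Sigma_{x^\dagger}A^T(A\Sigma_{x^\dagger}A^T+\Sigma_\varepsilon)^{-1},\qquad b^*=(I-W^*A)\mu_{x^\dagger}.$$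
   Context: All random variables are defined on a fixed probability space. $\operatorname{Cov}(x)=\mathbb{E}\big((x-\mathbb{E}x)(x-\mathbb{E}x)^T\big)$. Uncorrelated means that the cross-covariance $\mathbb{E}\big((x^\dagger-\mathbb{E}x^\dagger)(\varepsilon-\mathbb{E}\varepsilon)^T\big)$ is zero. $\|\cdot\|$ is the Euclidean norm and $\|z\|_\Omega=\sqrt{\langle z,\Omega z\rangle}$. The minimization in the upper level runs over symmetric positive definite noise weights $\Omega\in\mathbb{R}^{m\times m}$, regularization matrices $R\in\mathbb{R}^{k\times n}$ and offsets $x_0\in\mathbb{R}^n$ for which the lower level minimizer is unique, i.e. $A^T\Omega A+R^TR$ is invertible; the lower level solution is then $\hat x=(A^T\Omega A+R^TR)^{-1}(A^T\Omega y+R^TRx_0)$. *)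

(* Defs.v *)
From HB Require Import structures.
From mathcomp Require Import all_boot all_order all_algebra.
From mathcomp Require Import all_classical all_reals all_analysis.

Set Implicit Arguments.
Unset Strict Implicit.
Unset Printing Implicit Defensive.

Import Order.TTheory GRing.Theory Num.Theory.

Local Open Scope classical_set_scope.
Local Open Scope ring_scope.

Section Euclidean.
Context {R : realType}.

Definition dotv (n : nat) (u v : 'cV[R]_n) : R := (u^T *m v) 0 0.

(* MathComp-Analysis equips matrices with the sup norm as `|v|, so the
   Euclidean norm is introduced separately. *)
Definition enorm (n : nat) (v : 'cV[R]_n) : R := Num.sqrt (dotv v v).

Definition wnorm (n : nat) (Omega : 'M[R]_n) (v : 'cV[R]_n) : R :=
  Num.sqrt (dotv v (Omega *m v)).

Definition spd (n : nat) (Omega : 'M[R]_n) : Prop :=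
  Omega^T = Omega /\
  forall v : 'cV[R]_n, v != 0 -> 0 < dotv v (Omega *m v).

End Euclidean.

Definition argmin {R : realType} {X : Type} (f : X -> R) : set X :=
  [set u | forall v, f u <= f v].

Section RandomVectors.
Context {d : measure_display} {T : measurableType d} {R : realType}.
Variable P : probability T R.

Definition square_integrable (n : nat) (X : T -> 'cV[R]_n) : Prop :=
  forall i, (fun w => X w i 0) \in Lfun P 2%:E.

(* Extended-real moments are read back in R with [fine]; they are finite
   whenever the vectors are square-integrable. *)
Definition meanv (n : nat) (X : T -> 'cV[R]_n) : 'cV[R]_n :=
  \col_i fine ('E_P[fun w => (X w i 0)%R])%E.

Definition cross_cov (n m : nat) (X : T -> 'cV[R]_n) (Y : T -> 'cV[R]_m) :
    'M[R]_(n, m) :=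
  \matrix_(i, j) fine (covariance P (fun w => X w i 0) (fun w => Y w j 0)).

Definition cov (n : nat) (X : T -> 'cV[R]_n) : 'M[R]_n := cross_cov X X.

Definition uncorrelated (n m : nat)
    (X : T -> 'cV[R]_n) (Y : T -> 'cV[R]_m) : Prop :=
  cross_cov X Y = 0.

Definition mse (n m : nat) (x : T -> 'cV[R]_n) (y : T -> 'cV[R]_m)
    (f : 'cV[R]_m -> 'cV[R]_n) : \bar R :=
  ('E_P[fun w => (enorm (f (y w) - x w) ^+ 2)%R])%E.

Definition is_LMMSE (n m : nat) (x : T -> 'cV[R]_n) (y : T -> 'cV[R]_m)
    (f : 'cV[R]_m -> 'cV[R]_n) : Prop :=
  (exists (W : 'M[R]_(n, m)) (b : 'cV[R]_n), forall v, f v = W *m v + b) /\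
  forall (W : 'M[R]_(n, m)) (b : 'cV[R]_n),
    (mse x y f <= mse x y (fun v => W *m v + b)%R)%E.

End RandomVectors.

Section Bilevel.
Context {R : realType}.
Variables (m n k : nat) (A : 'M[R]_(m, n)).

Definition lower_objective (Omega : 'M[R]_m) (Reg : 'M[R]_(k, n))
    (x0 : 'cV[R]_n) (y : 'cV[R]_m) (x : 'cV[R]_n) : R :=
  2^-1 * wnorm Omega (A *m x - y) ^+ 2 + 2^-1 * enorm (Reg *m (x - x0)) ^+ 2.

Definition admissible (Omega : 'M[R]_m) (Reg : 'M[R]_(k, n)) : Prop :=
  spd Omega /\ A^T *m Omega *m A + Reg^T *m Reg \in unitmx.

Definition lower_solution (Omega : 'M[R]_m) (Reg : 'M[R]_(k, n))
    (x0 : 'cV[R]_n) (xhat : 'cV[R]_m -> 'cV[R]_n) : Prop :=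
  forall y, argmin (lower_objective Omega Reg x0 y) = [set xhat y].

(* The lower level problem is solved for every datum, so its solution is
   represented by the map sending a datum [y] to the unique minimizer. *)
Definition solves_bilevel {d : measure_display} {T : measurableType d}
    (P : probability T R) (x : T -> 'cV[R]_n) (y : T -> 'cV[R]_m)
    (Omega : 'M[R]_m) (Reg : 'M[R]_(k, n)) (x0 : 'cV[R]_n)
    (xhat : 'cV[R]_m -> 'cV[R]_n) : Prop :=
  [/\ admissible Omega Reg,
      lower_solution Omega Reg x0 xhat &
      forall (Omega' : 'M[R]_m) (Reg' : 'M[R]_(k, n)) (x0' : 'cV[R]_n)
             (xhat' : 'cV[R]_m -> 'cV[R]_n),
        admissible Omega' Reg' -> lower_solution Omega' Reg' x0' xhat' ->
        (mse P x y xhat <= mse P x y xhat')%E].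

End Bilevel.

Definition Wstar {R : realType} (m n : nat) (A : 'M[R]_(m, n))
    (Sx : 'M[R]_n) (Se : 'M[R]_m) : 'M[R]_(n, m) :=
  Sx *m A^T *m invmx (A *m Sx *m A^T + Se).

Definition bstar {R : realType} (m n : nat) (A : 'M[R]_(m, n))
    (Sx : 'M[R]_n) (Se : 'M[R]_m) (mu : 'cV[R]_n) : 'cV[R]_n :=
  (1%:M - Wstar A Sx Se *m A) *m mu.

(* Main.v *)
Require Import Defs.
From HB Require Import structures.
From mathcomp Require Import all_boot all_order all_algebra.
From mathcomp Require Import all_classical all_reals all_analysis.
From mathcomp Require Import ring lra.

(** The lower level solution map is always affine in the datum, and the LMMSE
map minimizes the mean squared error among _all_ affine maps. So it is enough
to see that the prescribed weights turn the lower level solution map into the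
LMMSE map: it is then optimal in a class that contains every competitor.

The lower level objective is a convex quadratic with Hessian
[M = A^T Omega A + R^T R]. Being positive semidefinite and invertible, [M] is
positive definite ([psd_spd]), so the minimizer is the solution of the normal
equations [M x = A^T Omega y + R^T R x0], which is affine in [y]
([argmin_lower], [lower_map_affine]). With [Omega = Se^-1], [R^T R = Sx^-1] and
[x0 = mu], multiplying by [M] identifies this solution with [W y + b] for
[W = Sx A^T (A Sx A^T + Se)^-1] and [b = (1 - W A) mu] ([lower_map_Wstar]).

Optimality of [W y + b] is the orthogonality principle. Its error
[W y + b - x] has mean zero, and its cross-covariance with [y] is
[W (A Sx A^T + Se) - Sx A^T = 0]. Any other affine map changes the error by
an affine function of [y], hence by something orthogonal to the error in [L^2],
which cannot decrease the mean square ([le_expectation_enorm_sqrD],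
[LMMSE_mse_min]). Covariance matrices are positive semidefinite, so their
invertibility provides all the definiteness that is needed ([cov_psd]). *)

Import Order.TTheory GRing.Theory Num.Theory.
Local Open Scope ring_scope.

Set Implicit Arguments.
Unset Strict Implicit.
Unset Printing Implicit Defensive.

(** * Inner products and positive definite matrices *)

Section LinearAlgebra.
Context {R : realType}.

Lemma dotvE n (u v : 'cV[R]_n) : dotv u v = \sum_i u i 0 * v i 0.
Proof. by rewrite /dotv mxE; apply: eq_bigr => i _; rewrite mxE. Qed.

Lemma dotvC n (u v : 'cV[R]_n) : dotv u v = dotv v u.
Proof. by rewrite !dotvE; apply: eq_bigr => i _; rewrite mulrC. Qed.

Lemma dotvDl n (u v w : 'cV[R]_n) : dotv (u + v) w = dotv u w + dotv v w.
Proof. by rewrite /dotv linearD mulmxDl mxE. Qed.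

Lemma dotvDr n (u v w : 'cV[R]_n) : dotv w (u + v) = dotv w u + dotv w v.
Proof. by rewrite /dotv mulmxDr mxE. Qed.

Lemma dotvZl n a (u v : 'cV[R]_n) : dotv (a *: u) v = a * dotv u v.
Proof. by rewrite /dotv linearZ -scalemxAl mxE. Qed.

Lemma dotvZr n a (u v : 'cV[R]_n) : dotv u (a *: v) = a * dotv u v.
Proof. by rewrite dotvC dotvZl dotvC. Qed.

Lemma dotv0 n (u : 'cV[R]_n) : dotv u 0 = 0.
Proof. by rewrite /dotv mulmx0 mxE. Qed.

Lemma dotv_mull m n (B : 'M[R]_(m, n)) u v :
  dotv (B *m u) v = dotv u (B^T *m v).
Proof. by rewrite /dotv trmx_mul mulmxA. Qed.

Lemma dotv_ge0 n (v : 'cV[R]_n) : 0 <= dotv v v.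
Proof. by rewrite dotvE; apply: sumr_ge0 => i _; rewrite -expr2 sqr_ge0. Qed.

Lemma dotv_gt0 n (v : 'cV[R]_n) : v != 0 -> 0 < dotv v v.
Proof.
move=> v0; rewrite lt_neqAle dotv_ge0 andbT eq_sym; apply: contra v0.
rewrite dotvE psumr_eq0 => [/allP z|i _]; last by rewrite -expr2 sqr_ge0.
apply/eqP/colP => i; rewrite !mxE.
by have /= := z i (mem_index_enum i); rewrite -expr2 sqrf_eq0 => /eqP.
Qed.

Lemma enorm_sqr n (v : 'cV[R]_n) : enorm v ^+ 2 = dotv v v.
Proof. by rewrite sqr_sqrtr ?dotv_ge0. Qed.

Definition psd n (S : 'M[R]_n) : Prop :=
  S^T = S /\ forall v : 'cV[R]_n, 0 <= dotv v (S *m v).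

Lemma quadD n (S : 'M[R]_n) (u v : 'cV[R]_n) : S^T = S ->
  dotv (u + v) (S *m (u + v)) =
    dotv u (S *m u) + 2 * dotv v (S *m u) + dotv v (S *m v).
Proof.
move=> symS; rewrite mulmxDr !dotvDl !dotvDr.
suff -> : dotv u (S *m v) = dotv v (S *m u) by ring.
by rewrite dotvC dotv_mull symS.
Qed.

Lemma spd_psd n (S : 'M[R]_n) : spd S -> psd S.
Proof.
move=> [symS posS]; split=> // v.
have [->|/posS/ltW//] := eqVneq v 0.
by rewrite mulmx0 dotv0.
Qed.

Lemma wnorm_sqr n (S : 'M[R]_n) v : spd S ->
  wnorm S v ^+ 2 = dotv v (S *m v).
Proof. by move=> /spd_psd[_ S0]; rewrite sqr_sqrtr. Qed.

Lemma psd_congr m n (S : 'M[R]_m) (B : 'M[R]_(m, n)) :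
  psd S -> psd (B^T *m S *m B).
Proof.
move=> [symS S0]; split=> [|v]; first by rewrite !trmx_mul trmxK symS mulmxA.
by rewrite -!mulmxA -dotv_mull.
Qed.

Lemma psd_gram m n (B : 'M[R]_(m, n)) : psd (B^T *m B).
Proof.
split=> [|v]; first by rewrite trmx_mul trmxK.
by rewrite -!mulmxA -dotv_mull dotv_ge0.
Qed.

Lemma psdD n (S S' : 'M[R]_n) : psd S -> psd S' -> psd (S + S').
Proof.
move=> [symS S0] [symS' S'0]; split=> [|v]; first by rewrite linearD/= symS symS'.
by rewrite mulmxDl dotvDr addr_ge0.
Qed.

Lemma psd_spdD n (S S' : 'M[R]_n) : psd S -> spd S' -> spd (S + S').
Proof.
move=> [symS S0] [symS' S'0]; split=> [|v v0].
  by rewrite linearD/= symS symS'.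
by rewrite mulmxDl dotvDr ltr_wpDl ?S'0.
Qed.

Lemma spd_unit n (S : 'M[R]_n) : spd S -> S \in unitmx.
Proof.
move=> [symS posS]; rewrite unitmxE unitfE; apply/det0P => -[v v0 vS].
have : v^T != 0 by rewrite -[0]trmx0 (inj_eq trmx_inj).
by move/posS; rewrite -[S]symS -trmx_mul vS trmx0 dotv0 ltxx.
Qed.

(** If [v^T S v = 0] with [v != 0], then [u = S v] is nonzero and the quadratic
form along the line [v + t u] is [2 t (u^T u) + t^2 (u^T S u)], with a nonzero
linear and no constant term: it becomes negative for small [t < 0]. *)
Lemma psd_spd n (S : 'M[R]_n) : psd S -> S \in unitmx -> spd S.
Proof.
move=> [symS S0] uS; split=> // v v0; rewrite lt_neqAle S0 andbT eq_sym.
apply/eqP => vSv; pose u := S *m v.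
have u0 : u != 0.
  by apply: contra v0 => /eqP u0; rewrite -(mulKmx uS v) -/u u0 mulmx0.
pose a := dotv u (S *m u); pose b := dotv u u.
have a0 : 0 <= a := S0 u.
have b0 : 0 < b := dotv_gt0 u0.
(* The minimizer of [2 t b + t^2 a] is [t = - b / a]; the shift [a + 1] keeps
   the denominator nonzero when [a = 0]. *)
pose t := - (b / (a + 1)).
have := S0 (v + t *: u).
rewrite quadD// vSv -!scalemxAr !dotvZl dotvZr -/u -/a -/b add0r.
have a1 : 0 < a + 1 by rewrite ltr_wpDl.
have -> : 2 * (t * b) + t * (t * a) = - (b / (a + 1)) ^+ 2 * (a + 2).
  by rewrite /t; field; rewrite gt_eqF.
by rewrite mulNr oppr_ge0 leNgt mulr_gt0 ?exprn_gt0 ?divr_gt0 ?ltr_wpDl.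
Qed.

(** The inverse is congruent to the matrix: [S^-1 = (S^-1)^T S S^-1]. *)
Lemma spd_inv n (S : 'M[R]_n) : spd S -> spd (invmx S).
Proof.
move=> spdS; have uS := spd_unit spdS; have [symS _] := spdS.
have symI : (invmx S)^T = invmx S by rewrite trmx_inv symS.
apply: psd_spd; last by rewrite unitmx_inv.
have -> : invmx S = (invmx S)^T *m S *m invmx S by rewrite symI mulVmx ?mul1mx.
exact/psd_congr/spd_psd.
Qed.

Lemma congr_addr_unit m n (B : 'M[R]_(m, n)) S S' : spd S -> spd S' ->
  B *m S *m B^T + S' \in unitmx.
Proof.
move=> /spd_psd/(psd_congr B^T) + spdS'; rewrite trmxK => psdB.
exact/spd_unit/psd_spdD.
Qed.

End LinearAlgebra.

(** * Means and covariances of random vectors *)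

Section SecondMoments.
Context {d : measure_display} {T : measurableType d} {R : realType}.
Variable P : probability T R.

Let PT_fin : (P setT \is a fin_num)%E.
Proof. exact: fin_num_measure. Qed.

Lemma Lfun2_Lfun1 (f : T -> R) : f \in Lfun P 2%:E -> f \in Lfun P 1%E.
Proof. exact: Lfun_subset12. Qed.

Lemma Lfun2D (f g : T -> R) : f \in Lfun P 2%:E -> g \in Lfun P 2%:E ->
  f + g \in Lfun P 2%:E.
Proof. by move=> f2 g2; rewrite rpredD ?lee1n. Qed.

Lemma Lfun2Z a (f : T -> R) : f \in Lfun P 2%:E -> a \o* f \in Lfun P 2%:E.
Proof. by apply: Lfun_scale; rewrite ler1n. Qed.

Lemma Lfun2_sum (I : Type) (r : seq I) (f : I -> T -> R) :
  (forall i, f i \in Lfun P 2%:E) -> \sum_(i <- r) f i \in Lfun P 2%:E.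
Proof. by move=> f2; rewrite rpred_sum ?lee1n. Qed.

Lemma expectation_sumr (I : Type) (r : seq I) (f : I -> T -> R) :
    (forall i, f i \in Lfun P 1%E) ->
  ('E_P[\sum_(i <- r) f i] = \sum_(i <- r) 'E_P[f i])%E.
Proof.
move=> f1; elim: r => [|i r IHr]; first by rewrite !big_nil expectation_cst.
by rewrite !big_cons expectationD ?IHr// rpred_sum.
Qed.

Lemma covariance_suml (I : Type) (r : seq I) (f : I -> T -> R) (g : T -> R) :
    (forall i, f i \in Lfun P 2%:E) -> g \in Lfun P 2%:E ->
  covariance P (\sum_(i <- r) f i) g = (\sum_(i <- r) covariance P (f i) g)%E.
Proof.
move=> f2 g2; elim: r => [|i r IHr]; first by rewrite !big_nil covariance_cst_l.
by rewrite !big_cons covarianceDl ?IHr// Lfun2_sum.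
Qed.

Lemma mulmx_coord m n (B : 'M[R]_(m, n)) (X : T -> 'cV[R]_n) i :
  (fun w => (B *m X w) i 0) = \sum_j (B i j \o* (fun w => X w j 0)).
Proof.
apply/funext => w; rewrite mxE fct_sumE.
by apply: eq_bigr => j _ /=; rewrite mulrC.
Qed.

Lemma square_integrable_mull m n (B : 'M[R]_(m, n)) (X : T -> 'cV[R]_n) :
  square_integrable P X -> square_integrable P (fun w => B *m X w).
Proof.
by move=> X2 i; rewrite mulmx_coord; apply: Lfun2_sum => j; exact: Lfun2Z.
Qed.

Lemma addmx_coord n (X Y : T -> 'cV[R]_n) i :
  (fun w => (X w + Y w) i 0) = (fun w => X w i 0) \+ (fun w => Y w i 0).
Proof. by apply/funext => w; rewrite mxE. Qed.

Lemma square_integrableD n (X Y : T -> 'cV[R]_n) :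
  square_integrable P X -> square_integrable P Y ->
  square_integrable P (fun w => X w + Y w).
Proof. by move=> X2 Y2 i; rewrite addmx_coord; exact: Lfun2D. Qed.

Lemma square_integrable_cst n (c : 'cV[R]_n) :
  square_integrable P (fun=> c).
Proof. by move=> i; exact: Lfun_cst. Qed.

Lemma meanvE n (X : T -> 'cV[R]_n) i : square_integrable P X ->
  ((meanv P X i 0)%:E = 'E_P[fun w => (X w i 0)%R])%E.
Proof. by move=> X2; rewrite mxE fineK// expectation_fin_num// Lfun2_Lfun1. Qed.

Lemma meanvD n (X Y : T -> 'cV[R]_n) :
  square_integrable P X -> square_integrable P Y ->
  meanv P (fun w => X w + Y w) = meanv P X + meanv P Y.
Proof.
move=> X2 Y2; apply/colP => i; rewrite [RHS]mxE; apply: EFin_inj.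
rewrite EFinD !meanvE//; last exact: square_integrableD.
by rewrite addmx_coord expectationD// Lfun2_Lfun1.
Qed.

Lemma meanv_cst n (c : 'cV[R]_n) : meanv P (fun=> c) = c.
Proof. by apply/colP => i; rewrite mxE expectation_cst. Qed.

Lemma meanv_mull m n (B : 'M[R]_(m, n)) (X : T -> 'cV[R]_n) :
  square_integrable P X -> meanv P (fun w => B *m X w) = B *m meanv P X.
Proof.
move=> X2; apply/colP => i; rewrite [RHS]mxE; apply: EFin_inj.
rewrite meanvE; last exact: square_integrable_mull.
rewrite mulmx_coord expectation_sumr; last first.
  by move=> j; exact/Lfun2_Lfun1/Lfun2Z.
rewrite -sumEFin; apply: eq_bigr => j _.
by rewrite expectationZl ?Lfun2_Lfun1// EFinM meanvE.
Qed.

Lemma cross_covE m n (X : T -> 'cV[R]_m) (Y : T -> 'cV[R]_n) i j :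
  square_integrable P X -> square_integrable P Y ->
  (cross_cov P X Y i j)%:E =
    covariance P (fun w => X w i 0) (fun w => Y w j 0).
Proof.
move=> X2 Y2; rewrite mxE fineK// covariance_fin_num ?Lfun2_mul_Lfun1//.
  exact: Lfun2_Lfun1.
exact: Lfun2_Lfun1.
Qed.

Lemma cross_covC m n (X : T -> 'cV[R]_m) (Y : T -> 'cV[R]_n) :
  cross_cov P Y X = (cross_cov P X Y)^T.
Proof. by apply/matrixP => i j; rewrite !mxE covarianceC. Qed.

Lemma cross_covDl m n (X X' : T -> 'cV[R]_m) (Y : T -> 'cV[R]_n) :
  square_integrable P X -> square_integrable P X' -> square_integrable P Y ->
  cross_cov P (fun w => X w + X' w) Y = cross_cov P X Y + cross_cov P X' Y.
Proof.
move=> X2 X'2 Y2; apply/matrixP => i j; rewrite [RHS]mxE; apply: EFin_inj.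
rewrite EFinD !cross_covE//; last exact: square_integrableD.
by rewrite addmx_coord covarianceDl.
Qed.

Lemma cross_cov_cstl m n (c : 'cV[R]_m) (Y : T -> 'cV[R]_n) :
  cross_cov P (fun=> c) Y = 0.
Proof. by apply/matrixP => i j; rewrite !mxE covariance_cst_l. Qed.

Lemma cross_cov_mull k m n (B : 'M[R]_(k, m)) (X : T -> 'cV[R]_m)
    (Y : T -> 'cV[R]_n) :
  square_integrable P X -> square_integrable P Y ->
  cross_cov P (fun w => B *m X w) Y = B *m cross_cov P X Y.
Proof.
move=> X2 Y2; apply/matrixP => i j; rewrite [RHS]mxE; apply: EFin_inj.
rewrite cross_covE//; last exact: square_integrable_mull.
rewrite mulmx_coord covariance_suml//; last by move=> l; exact: Lfun2Z.
rewrite -sumEFin; apply: eq_bigr => l _.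
rewrite covarianceZl ?Lfun2_mul_Lfun1 ?Lfun2_Lfun1//.
by rewrite EFinM cross_covE.
Qed.

Lemma cross_covDr m n (X : T -> 'cV[R]_m) (Y Y' : T -> 'cV[R]_n) :
  square_integrable P X -> square_integrable P Y -> square_integrable P Y' ->
  cross_cov P X (fun w => Y w + Y' w) = cross_cov P X Y + cross_cov P X Y'.
Proof.
move=> X2 Y2 Y'2.
by rewrite cross_covC cross_covDl// linearD/= -!cross_covC.
Qed.

Lemma cross_cov_cstr m n (X : T -> 'cV[R]_m) (c : 'cV[R]_n) :
  cross_cov P X (fun=> c) = 0.
Proof. by rewrite cross_covC cross_cov_cstl trmx0. Qed.

Lemma cross_cov_mulr k m n (B : 'M[R]_(k, n)) (X : T -> 'cV[R]_m)
    (Y : T -> 'cV[R]_n) :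
  square_integrable P X -> square_integrable P Y ->
  cross_cov P X (fun w => B *m Y w) = cross_cov P X Y *m B^T.
Proof.
by move=> X2 Y2; rewrite cross_covC cross_cov_mull// trmx_mul -cross_covC.
Qed.

(** [v^T (cov X) v] is the variance of the scalar random variable [v^T X]. *)
Lemma cov_psd n (X : T -> 'cV[R]_n) : square_integrable P X -> psd (cov P X).
Proof.
move=> X2; split=> [|v]; first by rewrite -cross_covC.
have vX2 := square_integrable_mull v^T X2.
have -> : dotv v (cov P X *m v) = cov P (fun w => v^T *m X w) 0 0.
  by rewrite /cov cross_cov_mull// cross_cov_mulr// trmxK.
by rewrite mxE fine_ge0// variance_ge0.
Qed.

Lemma dotv_coord n (X Y : T -> 'cV[R]_n) :
  (fun w => dotv (X w) (Y w)) =
    \sum_i ((fun w => X w i 0) \* (fun w => Y w i 0)).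
Proof. by apply/funext => w; rewrite dotvE fct_sumE. Qed.

Lemma dotv_Lfun1 n (X Y : T -> 'cV[R]_n) :
  square_integrable P X -> square_integrable P Y ->
  (fun w => dotv (X w) (Y w)) \in Lfun P 1%E.
Proof.
move=> X2 Y2; rewrite dotv_coord rpred_sum// => i _.
exact: Lfun2_mul_Lfun1.
Qed.

Lemma expectation_dotv_eq0 n (X Y : T -> 'cV[R]_n) :
  square_integrable P X -> square_integrable P Y ->
  meanv P X = 0 -> uncorrelated P X Y ->
  ('E_P[fun w => dotv (X w) (Y w)] = 0)%E.
Proof.
move=> X2 Y2 X0 XY0.
have XY1 i : (fun w => X w i 0) \* (fun w => Y w i 0) \in Lfun P 1%E.
  exact: Lfun2_mul_Lfun1.
rewrite dotv_coord (expectation_sumr _ XY1); apply: big1 => i _.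
have := cross_covE i i X2 Y2; rewrite XY0.
rewrite covarianceE ?Lfun2_mul_Lfun1 ?Lfun2_Lfun1//.
by rewrite -!meanvE// X0 !mxE mul0e sube0 => <-.
Qed.

(** Perturbing a centred vector by an uncorrelated one cannot decrease the
mean square: integrate the pointwise bound [|X + Y|^2 >= |X|^2 + 2 <X, Y>], whose
last term has expectation zero. *)
Lemma le_expectation_enorm_sqrD n (X Y : T -> 'cV[R]_n) :
  square_integrable P X -> square_integrable P Y ->
  meanv P X = 0 -> uncorrelated P X Y ->
  ('E_P[fun w => (enorm (X w) ^+ 2)%R]
     <= 'E_P[fun w => (enorm (X w + Y w) ^+ 2)%R])%E.
Proof.
move=> X2 Y2 X0 XY0.
have XX1 := dotv_Lfun1 X2 X2; have XY1 := dotv_Lfun1 X2 Y2.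
have XYZ1 : 2 \o* (fun w => dotv (X w) (Y w)) \in Lfun P 1%E.
  exact: Lfun_scale.
have F1 : (fun w => dotv (X w) (X w)) + 2 \o* (fun w => dotv (X w) (Y w))
    \in Lfun P 1%E by exact: rpredD.
have S1 := dotv_Lfun1 (square_integrableD X2 Y2) (square_integrableD X2 Y2).
under eq_fun do rewrite enorm_sqr.
under [in leRHS]eq_fun do rewrite enorm_sqr.
have -> : ('E_P[fun w => dotv (X w) (X w)] =
    'E_P[((fun w => dotv (X w) (X w)) \+ 2 \o* (fun w => dotv (X w) (Y w)))%R])%E.
  rewrite expectationD// expectationZl// (expectation_dotv_eq0 X2 Y2)//.
  by rewrite mule0 adde0.
rewrite unlock; apply: le_integral => //.
- by move/Lfun1_integrable : F1.
- by move/Lfun1_integrable : S1.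
- move=> w _; rewrite lee_fin/= dotvDl !dotvDr (dotvC (Y w) (X w)).
  by have := dotv_ge0 (Y w); lra.
Qed.

End SecondMoments.

(** * Optimality of the LMMSE map *)

Section LMMSE.
Context {d : measure_display} {T : measurableType d} {R : realType}.
Variable P : probability T R.
Variables (m n : nat) (A : 'M[R]_(m, n)).
Variables (x : T -> 'cV[R]_n) (eps : T -> 'cV[R]_m).
Hypotheses (x_L2 : square_integrable P x) (eps_L2 : square_integrable P eps).
Hypotheses (x_eps : uncorrelated P x eps) (eps_mean : meanv P eps = 0).

Let y w := A *m x w + eps w.
Let W := Wstar A (cov P x) (cov P eps).
Let b := bstar A (cov P x) (cov P eps) (meanv P x).
Let err w := W *m y w + b - x w.

(* In terms of [x] and [eps], whose covariances are known. *)
Let errE : err = fun w => ((W *m A - 1%:M) *m x w + W *m eps w) + b.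
Proof.
apply/funext => w; rewrite /err /y mulmxDr mulmxBl mul1mx !mulmxA.
by rewrite [X in _ = X + _]addrAC [RHS]addrAC.
Qed.

Let y_L2 : square_integrable P y.
Proof. by apply: square_integrableD => //; exact: square_integrable_mull. Qed.

Let lin_L2 :
  square_integrable P (fun w => (W *m A - 1%:M) *m x w + W *m eps w).
Proof. by apply: square_integrableD; exact: square_integrable_mull. Qed.

Let err_L2 : square_integrable P err.
Proof.
by rewrite errE; apply: square_integrableD => //; exact: square_integrable_cst.
Qed.

Lemma LMMSE_error_mean : meanv P err = 0.
Proof.
rewrite errE meanvD//; last exact: square_integrable_cst.
rewrite meanvD; [|exact: square_integrable_mull..].
rewrite meanv_cst !meanv_mull// eps_mean mulmx0 addr0 /b /bstar -/W.
by rewrite -mulmxDl addrA subrK subrr mul0mx.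
Qed.

(** The equation [cross_cov err y = 0] reads
[(W A - 1) Sx A^T + W Se = 0], that is [W (A Sx A^T + Se) = Sx A^T]: it is the
defining property of [W]. *)
Lemma LMMSE_error_uncorrelated :
  A *m cov P x *m A^T + cov P eps \in unitmx -> uncorrelated P err y.
Proof.
move=> uS; have Ax_L2 := square_integrable_mull A x_L2.
have eps_x : cross_cov P eps x = 0 by rewrite cross_covC x_eps trmx0.
have x_y : cross_cov P x y = cov P x *m A^T.
  by rewrite cross_covDr// cross_cov_mulr// x_eps addr0.
have eps_y : cross_cov P eps y = cov P eps.
  by rewrite cross_covDr// cross_cov_mulr// eps_x mul0mx add0r.
have WS : W *m (A *m cov P x *m A^T + cov P eps) = cov P x *m A^T.
  by rewrite /W /Wstar mulmxKV.
rewrite /uncorrelated errE cross_covDl//; last exact: square_integrable_cst.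
rewrite cross_cov_cstl addr0 cross_covDl//; [|exact: square_integrable_mull..].
rewrite !cross_cov_mull// x_y eps_y mulmxBl mul1mx addrAC.
by rewrite -[X in _ - X]WS mulmxDr !mulmxA subrr.
Qed.

(** The errors of two affine estimators differ by an affine function of [y],
which is uncorrelated with [err]. *)
Lemma LMMSE_mse_min W' b' :
  A *m cov P x *m A^T + cov P eps \in unitmx ->
  (mse P x y (fun v => W *m v + b)%R <= mse P x y (fun v => W' *m v + b')%R)%E.
Proof.
move=> uS; pose g w := (W' - W) *m y w + (b' - b).
have Dy_L2 := square_integrable_mull (W' - W) y_L2.
have g_L2 : square_integrable P g.
  by apply: square_integrableD => //; exact: square_integrable_cst.
have err_g : uncorrelated P err g.
  rewrite /uncorrelated cross_covDr//; last exact: square_integrable_cst.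
  by rewrite cross_cov_cstr addr0 cross_cov_mulr// LMMSE_error_uncorrelated// mul0mx.
have := le_expectation_enorm_sqrD err_L2 g_L2 LMMSE_error_mean err_g.
rewrite /mse; congr (_ <= expectation P _)%E.
apply/funext => w; congr (enorm _ ^+ 2); rewrite /err /g mulmxBl.
by rewrite addrAC addrACA !subrKC.
Qed.

End LMMSE.

(** * The lower level problem *)

Section LowerLevel.
Context {R : realType}.
Variables (m n k : nat) (A : 'M[R]_(m, n)).

Definition normal_mx (Omega : 'M[R]_m) (Reg : 'M[R]_(k, n)) : 'M[R]_n :=
  A^T *m Omega *m A + Reg^T *m Reg.

Definition normal_rhs (Omega : 'M[R]_m) (Reg : 'M[R]_(k, n)) (x0 : 'cV[R]_n)
    (y : 'cV[R]_m) : 'cV[R]_n :=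
  A^T *m Omega *m y + Reg^T *m Reg *m x0.

Lemma normal_mx_spd Omega Reg : admissible A Omega Reg ->
  spd (normal_mx Omega Reg).
Proof.
move=> [/spd_psd psdO]; apply: psd_spd.
by apply: psdD; [exact: psd_congr | exact: psd_gram].
Qed.

(** At a solution [u] of the normal equations the gradient vanishes, so only
the constant and the quadratic term of the expansion around [u] remain. *)
Lemma lower_objectiveD Omega Reg x0 y u h : spd Omega ->
  normal_mx Omega Reg *m u = normal_rhs Omega Reg x0 y ->
  lower_objective A Omega Reg x0 y (u + h) =
    lower_objective A Omega Reg x0 y u
      + 2^-1 * dotv h (normal_mx Omega Reg *m h).
Proof.
move=> spdO normal_eq; have [symO _] := spdO.
rewrite /lower_objective !wnorm_sqr// !enorm_sqr.
have -> : A *m (u + h) - y = (A *m u - y) + A *m h by rewrite mulmxDr addrAC.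
have -> : Reg *m (u + h - x0) = Reg *m (u - x0) + Reg *m h.
  by rewrite -mulmxDr addrAC.
rewrite quadD//.
have := quadD (Reg *m (u - x0)) (Reg *m h) (trmx1 R k).
rewrite !mul1mx => ->.
rewrite !dotv_mull.
have : dotv h (normal_mx Omega Reg *m u - normal_rhs Omega Reg x0 y) = 0.
  by rewrite normal_eq subrr dotv0.
have -> : normal_mx Omega Reg *m u - normal_rhs Omega Reg x0 y =
    A^T *m (Omega *m (A *m u - y)) + Reg^T *m (Reg *m (u - x0)).
  by rewrite /normal_mx /normal_rhs !mulmxBr !mulmxDl !mulmxA opprD addrACA.
rewrite dotvDr /normal_mx mulmxDl dotvDr -!mulmxA.
lra.
Qed.

Definition lower_map Omega Reg x0 (y : 'cV[R]_m) : 'cV[R]_n :=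
  invmx (normal_mx Omega Reg) *m normal_rhs Omega Reg x0 y.

Lemma argmin_lower Omega Reg x0 y : admissible A Omega Reg ->
  argmin (lower_objective A Omega Reg x0 y) =
    [set lower_map Omega Reg x0 y]%classic.
Proof.
move=> adm; have [symM posM] := normal_mx_spd adm; have [spdO uM] := adm.
set xh := lower_map Omega Reg x0 y.
have nxh : normal_mx Omega Reg *m xh = normal_rhs Omega Reg x0 y.
  by rewrite mulKVmx.
have objE x : lower_objective A Omega Reg x0 y x =
    lower_objective A Omega Reg x0 y xh
      + 2^-1 * dotv (x - xh) (normal_mx Omega Reg *m (x - xh)).
  by rewrite -lower_objectiveD// addrC subrK.
apply/seteqP; split=> [x /(_ xh)|_ -> x].
  rewrite objE => le_x; apply/eqP; rewrite -subr_eq0.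
  by apply/negPn/negP => /posM; lra.
rewrite [leRHS]objE lerDl mulr_ge0 ?invr_ge0 ?ler0n//.
by apply: (spd_psd _).2.
Qed.

Lemma lower_mapP Omega Reg x0 : admissible A Omega Reg ->
  lower_solution A Omega Reg x0 (lower_map Omega Reg x0).
Proof. by move=> adm y; exact: argmin_lower. Qed.

Lemma lower_solutionE Omega Reg x0 xhat : admissible A Omega Reg ->
  lower_solution A Omega Reg x0 xhat -> xhat =1 lower_map Omega Reg x0.
Proof.
move=> adm sol y; have := sol y; rewrite argmin_lower// => /seteqP[+ _].
by move=> /(_ _ erefl).
Qed.

(** This places every admissible competitor of the upper level problem among
the affine estimators. *)
Lemma lower_map_affine Omega Reg x0 y :
  lower_map Omega Reg x0 y =
    (invmx (normal_mx Omega Reg) *m A^T *m Omega) *m y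
      + invmx (normal_mx Omega Reg) *m (Reg^T *m Reg *m x0).
Proof. by rewrite /lower_map /normal_rhs mulmxDr !mulmxA. Qed.

(** Both sides agree after multiplication by the normal matrix
[M = A^T Se^-1 A + Sx^-1], since
[M Sx A^T = A^T Se^-1 A Sx A^T + A^T = A^T Se^-1 (A Sx A^T + Se)] gives
[M W = A^T Se^-1], and then [M b = M mu - A^T Se^-1 A mu = Sx^-1 mu]. *)
Lemma lower_map_Wstar Sx Se (Reg : 'M[R]_(k, n)) mu : spd Sx -> spd Se ->
  Reg^T *m Reg = invmx Sx -> admissible A (invmx Se) Reg ->
  forall y, lower_map (invmx Se) Reg mu y =
    Wstar A Sx Se *m y + bstar A Sx Se mu.
Proof.
move=> spdx spde RegE [_ uM] y.
have ux := spd_unit spdx; have ue := spd_unit spde.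
have uS := congr_addr_unit A spdx spde.
have MW : normal_mx (invmx Se) Reg *m Wstar A Sx Se = A^T *m invmx Se.
  rewrite /Wstar !mulmxA; apply: (canLR (mulmxK uS)).
  rewrite /normal_mx RegE mulmxDr !mulmxDl mulVmx// mul1mx !mulmxA.
  by rewrite mulmxKV.
rewrite /lower_map; apply: (canLR (mulKmx uM)); rewrite -/(normal_mx _ _) /bstar.
move: (Wstar A Sx Se) MW => W MW.
rewrite mulmxDr !mulmxA mulmxBr mulmx1 !mulmxA MW /normal_rhs /normal_mx RegE.
by rewrite [_ + invmx Sx]addrC addrK.
Qed.

End LowerLevel.

(** * The bilevel problem *)

Theorem theorem4p1 (d : measure_display) (T : measurableType d) (R : realType)
    (P : probability T R) (m n k : nat) (A : 'M[R]_(m, n))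
    (x : T -> 'cV[R]_n) (eps y : T -> 'cV[R]_m)
    (mux : 'cV[R]_n) (Sx : 'M[R]_n) (Se : 'M[R]_m)
    (x_L2 : square_integrable P x) (eps_L2 : square_integrable P eps)
    (x_eps : uncorrelated P x eps)
    (x_mean : meanv P x = mux) (x_cov : cov P x = Sx)
    (eps_mean : meanv P eps = 0) (eps_cov : cov P eps = Se)
    (Sx_unit : Sx \in unitmx) (Se_unit : Se \in unitmx)
    (yE : forall w, y w = A *m x w + eps w)
    (Omega : 'M[R]_m) (Reg : 'M[R]_(k, n)) (x0 : 'cV[R]_n)
    (OmegaE : Omega = invmx Se) (RegE : Reg^T *m Reg = invmx Sx)
    (x0E : x0 = mux) :
  exists xhat : 'cV[R]_m -> 'cV[R]_n,
    [/\ solves_bilevel A P x y Omega Reg x0 xhat,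
        is_LMMSE P x y xhat &
        forall v : 'cV[R]_m, xhat v = Wstar A Sx Se *m v + bstar A Sx Se mux].
Proof.
have /(psd_spd (cov_psd x_L2)) spdx : cov P x \in unitmx by rewrite x_cov.
have /(psd_spd (cov_psd eps_L2)) spde : cov P eps \in unitmx by rewrite eps_cov.
have uS := congr_addr_unit A spdx spde.
subst mux Sx Se Omega x0.
have {yE}-> : y = fun w => A *m x w + eps w by exact/funext.
have adm : admissible A (invmx (cov P eps)) Reg.
  split; first exact: spd_inv.
  rewrite RegE; apply: spd_unit; apply: psd_spdD (spd_inv spdx).
  exact/psd_congr/spd_psd/spd_inv.
pose xhat := lower_map A (invmx (cov P eps)) Reg (meanv P x).
have xhatE v : xhat v = Wstar A (cov P x) (cov P eps) *m v
    + bstar A (cov P x) (cov P eps) (meanv P x).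
  exact: lower_map_Wstar.
have xhat_min (W : 'M[R]_(n, m)) (b : 'cV[R]_n) :
  (mse P x (fun w => A *m x w + eps w)%R xhat
    <= mse P x (fun w => A *m x w + eps w)%R (fun v => W *m v + b)%R)%E.
  by rewrite (funext xhatE); exact: LMMSE_mse_min.
exists xhat; split=> //.
- split=> // [|Omega Reg' x0 xhat' adm' sol']; first exact: lower_mapP.
  rewrite (funext (lower_solutionE adm' sol')).
  by rewrite (funext (lower_map_affine _ _ _ _)).
- by split=> //; do 2!eexists; exact: xhatE.
Qed.
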